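(* For every term $M$, every environment $e:\mathrm{Var}\to\mathrm{Val}$ with $\mathrm{FV}(M)\subseteq\{x: e(x)\neq\emptyset\}$, and every tossing process $T$, $$\lambda\omega.\,[\![M]\!]e(T\omega)\;=\;\psi[\![M]\!](\lambda x\,\omega.\,e(x))\,T$$ (in particular the right-hand side is defined).
   Context: Syntax: terms $M::=x\mid\lambda x.M\mid MN\mid M\oplus N$ over a countable set $\mathrm{Var}$ of variables; $\mathrm{FV}(M)$ is the set of free variables. Coins and tossing processes: $\Omega=2^\omega$, infinite binary sequences with the uniform (Lebesgue) product measure $\Pr$ ($\Pr(\{\alpha: x\prec\alpha\})=2^{-|x|}$, where $x\prec\alpha$ means the finite string $x$ is a prefix of $\alpha$; $I_x=\{\alpha:x\prec\alpha\}$). A tossing process is a measurable $T:2^\omega\to 2^\omega$ with $\Pr(T^{-1}(A))=\Pr(A)$ for all Borel $A$. $\mathrm{hd}\,\alpha=\alpha_0$, $\mathrm{tl}\,\alpha=\alpha_1\alpha_2\cdots$, and $\pi_i(\alpha)=\alpha_i\alpha_{i+3}\alpha_{i+6}\cdots$ for $i=0,1,2$. Domain: $Q_0=\{\emptyset\}$, $Q_{n+1}=Q_n\uplus(2^*\times\mathcal P_{\mathrm{fin}}(Q_n)\times Q_n)$, $Q=\bigcup_nQ_n$, $\mathrm{Val}=\mathcal P(Q)$ ordered by inclusion. $\mathrm{fun}(a)(\beta)(v)=\{q:\exists x\prec\beta\ \exists c\in\mathcal P_{\mathrm{fin}}(v)\ (x,c,q)\in a\}$ and $\mathrm{lam}(f)=\{(x,c,q)\in2^*\times\mathcal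 P_{\mathrm{fin}}(Q)\times Q:\forall\beta\in I_x\ q\in f\beta c\}\cup\{\emptyset\}$ for $f:2^\omega\to\mathrm{Val}\to\mathrm{Val}$. Deterministic semantics $[\![M]\!]:(\mathrm{Var}\to\mathrm{Val})\to2^\omega\to\mathrm{Val}$: $[\![x]\!]e\alpha=e(x)$; $[\![MN]\!]e\alpha=\mathrm{fun}([\![M]\!]e(\pi_0\alpha))(\pi_1\alpha)([\![N]\!]e(\pi_2\alpha))$; $[\![\lambda x.M]\!]e\alpha=\mathrm{lam}(\lambda\beta v.[\![M]\!](e[v/x])\beta)$ with the inner function strict (value $\emptyset$ when $v=\emptyset$); $[\![M\oplus N]\!]e\alpha=[\![M]\!]e(\mathrm{tl}\,\alpha)$ if $\mathrm{hd}\,\alpha=1$ and $[\![N]\!]e(\mathrm{tl}\,\alpha)$ if $\mathrm{hd}\,\alpha=0$. Stochastic semantics: $\mathrm{RV}$ is the set of functions $\Omega\to\mathrm{Val}$, stochastic environments are maps $E:\mathrm{Var}\to\mathrm{RV}$, and $\psi[\![M]\!]ET\in\mathrm{RV}$ (possibly undefined) for $T$ a tossing process is defined by: $\psi[\![x]\!]ET=E(x)$; $\psi[\![MN]\!]ET=\lambda\omega.\mathrm{fun}(\psi[\![M]\!]E(\pi_0\circ T)\omega)(\pi_1(T\omega))(\psi[\![N]\!]E(\pi_2\circ T)\omega)$; $\psi[\![M\oplus N]\!]ET=\lambda\omega.$ ($\psi[\![M]\!]E(\mathrm{tl}\circ T)\omega$ if $\mathrm{hd}(T\omega)=1$, else $\psi[\![N]\!]E(\mathrm{tl}\circ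 T)\omega$); and $\psi[\![\lambda x.M]\!]ET$ is defined iff there is $f:\Omega\to(2^\omega\to\mathrm{Val}\to\mathrm{Val})$ with $f(\omega)(\beta)(\emptyset)=\emptyset$ for all $\omega,\beta$ such that for every tossing process $T'$ and every $R\in\mathrm{RV}$, $\psi[\![M]\!](E[R/x])T'$ is defined and equals $f(\omega)(T'\omega)(R\omega)$ at every $\omega$ with $R\omega\neq\emptyset$; then ($f$ being unique) $\psi[\![\lambda x.M]\!]ET=\lambda\omega.\mathrm{lam}(f(\omega))$. (This unfolds the paper's operators $\mathrm{Fun},\mathrm{Lam}$: $\mathrm{Fun}\,F\,g\,h\,\omega=\mathrm{fun}(F\omega)(g\omega)(h\omega)$ and $\mathrm{Lam}$ is its inverse on its image.) *)

(* Defs.v *)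
From HB Require Import structures.
From mathcomp Require Import all_boot all_order all_algebra finmap lra.
From mathcomp Require Import all_classical all_reals all_analysis measurable_realfun.
Set Implicit Arguments.
Unset Strict Implicit.
Unset Printing Implicit Defensive.

Import Order.TTheory GRing.Theory Num.Theory.
Local Open Scope classical_set_scope.
Local Open Scope ring_scope.

(* Both the sample space and 2^omega: infinite bit strings (1 is [true]) with
   the Borel sigma-algebra of the Cantor space. *)
Definition Omega := g_sigma_algebraType (@open cantor_space).

Definition prefix_of (x : seq bool) (alpha : Omega) : Prop :=
  mkseq alpha (size x) = x.

Definition cyl (x : seq bool) : set Omega := [set alpha | prefix_of x alpha].

Definition hd (alpha : Omega) : bool := alpha 0%N.
Definition reindex (f : nat -> nat) (alpha : Omega) : Omega :=
  fun n => alpha (f n).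
Definition tl : Omega -> Omega := reindex S.
(* pi_i alpha = alpha_i alpha_(i+3) alpha_(i+6) ..., used for i = 0, 1, 2. *)
Definition third (i : nat) : Omega -> Omega := reindex (fun n => i + 3 * n)%N.

Lemma prefix_ofP x alpha :
  prefix_of x alpha <-> forall i, (i < size x)%N -> alpha i = nth false x i.
Proof.
split=> [<- i|h]; first by rewrite size_mkseq => ix; rewrite nth_mkseq.
by apply: (@eq_from_nth _ false); rewrite ?size_mkseq// => i ix;
  rewrite nth_mkseq ?h.
Qed.

Lemma prefix_of_cons b x alpha :
  prefix_of (b :: x) alpha <-> hd alpha = b /\ prefix_of x (tl alpha).
Proof.
split=> [/prefix_ofP h|[h /prefix_ofP h']].
  split; first exact: (h 0%N).
  by apply/prefix_ofP => i ix; exact: (h i.+1).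
by apply/prefix_ofP => -[|i] //= ix; exact: h'.
Qed.

Lemma cyl_nil : cyl [::] = setT.
Proof. by apply/seteqP; split. Qed.

Lemma measurable_coord n b : measurable [set alpha : Omega | alpha n = b].
Proof.
apply: sub_sigma_algebra.
apply: (@open_comp cantor_space bool (fun a => a n) [set b]).
  by move=> a _; exact: (@proj_continuous nat (fun=> bool) n).
exact: discrete_open.
Qed.

Lemma measurable_cyl x : measurable (cyl x).
Proof.
rewrite (_ : cyl x = \bigcap_(i in `I_(size x)) [set a : Omega | a i = nth false x i]).
  apply: fin_bigcap_measurable => [|i _]; first exact: finite_II.
  exact: measurable_coord.
by apply/seteqP; split=> a; rewrite /cyl /= prefix_ofP.
Qed.

Lemma open_cyl (U : set cantor_space) : open U ->
  U = \bigcup_(x in [set x | cyl x `<=` U]) cyl x.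
Proof.
move=> oU; apply/seteqP; split=> [a Ua|a [x /= xU /xU//]].
apply: contrapT => na.
have /choice[g gP] n : exists b : Omega, cyl (mkseq a n) b /\ ~ U b.
  apply: contrapT => nn; apply: na; exists (mkseq a n); last first.
    by rewrite /cyl /= /prefix_of size_mkseq.
  by move=> b ab; apply: contrapT => nUb; apply: nn; exists b.
have ga : (g : nat -> cantor_space) @ \oo --> (a : cantor_space).
  apply/cvg_sup => N V [W] [[Z] oZ <-] WfN WV.
  apply: (filterS WV); rewrite nbhs_simpl; exists N.+1 => // i /= Ni.
  have [/prefix_ofP/(_ N)] := gP i.
  by rewrite size_mkseq nth_mkseq// => -> //.
have [N _ /(_ N)] := ga U (open_nbhs_nbhs (conj oU Ua)).
by move=> /(_ (leqnn N)) UN; have [_] := gP N.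
Qed.

Definition cyls : set (set Omega) := [set A | A = set0 \/ exists x, A = cyl x].

Lemma measurable_Omega : @measurable _ Omega = <<s cyls>>.
Proof.
apply/seteqP; split; last first.
  apply: smallest_sub; first exact: sigma_algebra_measurable.
  by move=> _ [->|[x ->]]; [exact: measurable0|exact: measurable_cyl].
apply: smallest_sub; first exact: smallest_sigma_algebra.
move=> U /open_cyl ->.
have := @bigcup_mkcond Omega (seq bool) [set x | cyl x `<=` U] cyl => ->.
apply: (@countable_bigcupT_measurable _ (g_sigma_algebraType cyls) (seq bool)) => //.
move=> x; case: ifPn => _; last exact: measurable0.
by apply: sub_sigma_algebra; right; exists x.
Qed.

Lemma cyls_setI : setI_closed cyls.
Proof.
move=> _ _ [->|[x ->]] [->|[y ->]]; rewrite ?set0I ?setI0; [by left..|].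
wlog xy : x y / (size x <= size y)%N.
  by move=> h; case: (leqP (size x) (size y)) => [/h//|/ltnW/h]; rewrite setIC.
have [yx|yx] := pselect (take (size x) y = x); [right; exists y|left].
  apply/seteqP; split=> [a []//|a ya]; split=> //.
  by apply/prefix_ofP => i ix; rewrite -yx nth_take//;
    exact: (iffLR (prefix_ofP _ _) ya _ (leq_trans ix xy)).
apply/seteqP; split=> // a [/= xa ya]; apply: yx.
apply: (@eq_from_nth _ false); rewrite size_take_min (minn_idPl xy)// => i ix.
rewrite nth_take// -(iffLR (prefix_ofP _ _) ya _ (leq_trans ix xy)).
exact: (iffLR (prefix_ofP _ _) xa).
Qed.

Lemma Omega_measure_unique (R : realType) (m1 m2 : {measure set Omega -> \bar R}) :
  (m1 setT < +oo)%E -> (forall x, m1 (cyl x) = m2 (cyl x)) ->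
  forall A, measurable A -> m1 A = m2 A.
Proof.
move=> m1T m12; apply: (measure_unique cyls (fun=> setT) measurable_Omega cyls_setI).
- by move=> _; right; exists [::]; rewrite cyl_nil.
- by rewrite bigcup_const.
- by move=> _ [->|[x ->]]; rewrite ?measure0.
- by [].
Qed.

Section Pr.
Variable R : realType.

(* The fair-coin measure is the image of the uniform distribution on [0, 1]
   under binary expansion; [digits t] is the binary expansion of t in [0, 1[,
   read off the orbit of t under the doubling map. Pr is determined by its
   values on cylinders, see [Pr_cyl] and [Omega_measure_unique]. *)
Definition doubling (t : R) : R := if 2^-1 <= t then 2 * t - 1 else 2 * t.

Definition digits (t : measurableTypeR R) : Omega :=
  fun n => 2^-1 <= iter n doubling t.

Lemma measurable_doubling : measurable_fun setT doubling.
Proof.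
apply: measurable_fun_if => //=; first exact: measurable_fun_ler.
by apply: measurable_funTS; apply: measurable_funB => //; exact: measurable_funM.
Qed.

Lemma measurable_to_Omega d (T : measurableType d) (f : T -> Omega) :
  (forall n b, measurable [set t | f t n = b]) -> measurable_fun setT f.
Proof.
move=> mf; apply: (measurability cyls measurable_Omega) => _ [_ [->|[x ->]] <-].
  by rewrite preimage_set0 setI0.
rewrite setTI (_ : _ @^-1` _ =
    \bigcap_(i in `I_(size x)) [set t | f t i = nth false x i]).
  by apply: fin_bigcap_measurable => [|i _]; [exact: finite_II|exact: mf].
by apply/seteqP; split=> a; rewrite /cyl /= prefix_ofP.
Qed.

Lemma measurable_digits : measurable_fun [set: measurableTypeR R] digits.
Proof.
apply: measurable_to_Omega => n b.
have mi : measurable_fun setT (fun t => iter n doubling t).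
  elim: n => [|n ih]; first exact: measurable_id.
  exact: (measurableT_comp measurable_doubling ih).
have : measurable_fun setT (fun t => 2^-1 <= iter n doubling t).
  exact: measurable_fun_ler.
move=> /(_ measurableT [set b] I); rewrite setTI.
by [].
Qed.

HB.instance Definition _ :=
  isMeasurableFun.Build _ _ (measurableTypeR R) Omega digits measurable_digits.

Definition Pr : probability Omega R :=
  distribution (uniform_prob (@ltr01 R)) digits.

Lemma digits_cyl x : exists2 a : R, 0 <= a /\ a + 2^-1 ^+ size x <= 1 &
  forall t, 0 <= t < 1 -> cyl x (digits t) <-> a <= t < a + 2^-1 ^+ size x.
Proof.
elim: x => [|b x [a [a0 a1] ax]].
  by exists 0; [rewrite /= expr0; lra|move=> t; rewrite cyl_nil /= expr0 add0r].
have p0 : 0 <= 2^-1 ^+ size x :> R by rewrite exprn_ge0.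
exists ((a + b%:R) / 2).
  by case: b => /=; rewrite exprS; lra.
move=> t t01; rewrite /cyl /= prefix_of_cons.
have -> : tl (digits t) = digits (doubling t).
  by apply/funext => n; rewrite /tl /reindex /digits iterSr.
rewrite /hd /digits /= exprS.
have [t2|t2] := leP 2^-1 t; last first.
  have e : doubling t = 2 * t by rewrite /doubling leNgt t2.
  have /ax : 0 <= doubling t < 1 by rewrite e; lra.
  rewrite e /cyl /= => h; split; first by case=> <- /h /=; lra.
  case: b => /=; last by move=> ?; split=> //; apply/h; lra.
  by lra.
have e : doubling t = 2 * t - 1 by rewrite /doubling t2.
have /ax : 0 <= doubling t < 1 by rewrite e; lra.
rewrite e /cyl /= => h; split; first by case=> <- /h /=; lra.
case: b => /=; first by move=> ?; split=> //; apply/h; lra.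
by lra.
Qed.

Lemma Pr_cyl x : Pr (cyl x) = (2^-1 ^+ size x)%:E.
Proof.
have [a [a0 a1] ax] := digits_cyl x.
have p0 : 0 <= 2^-1 ^+ size x :> R by rewrite exprn_ge0.
rewrite /Pr /distribution /pushforward /= /uniform_prob.
set D := digits @^-1` _.
have mD : measurable D.
  by rewrite -[D]setTI; exact: measurable_digits (measurable_cyl x).
rewrite integral_uniform_pdf (eq_integral (fun=> 1%:E)); last first.
  by move=> t /set_mem[_]; rewrite /= in_itv /= /uniform_pdf => ->; rewrite subr0 invr1.
rewrite integral_cst ?mul1e; last exact: measurableI.
have -> : D `&` `[0, 1] = `[a, (a + 2^-1 ^+ size x)%R[ `|` (D `&` [set 1]).
  apply/seteqP; split=> t /=; rewrite !in_itv /=.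
    move=> [Dt /andP[t0]]; rewrite le_eqVlt => /orP[/eqP t1|t1]; first by right.
    by left; apply: (iffLR (ax t _) Dt); rewrite t0.
  move=> [h|[Dt t1]]; last by split=> //; rewrite t1 lexx ler01.
  have t01 : 0 <= t < 1.
    by case/andP: h => at_ ta; rewrite (le_trans a0 at_) (lt_le_trans ta a1).
  split; first exact: (iffRL (ax t t01) h).
  by case/andP: t01 => t0 /ltW t1; apply/andP; split; [exact: t0|exact: t1].
rewrite measureU//=; first last.
- apply/seteqP; split=> t //= -[+ [_ t1]]; rewrite t1 in_itv /= => /andP[_].
  by rewrite ltNge a1.
- exact: measurableI.
rewrite lebesgue_measure_itv /= lte_fin ltrDl exprn_gt0// -EFinB addrAC subrr add0r.
rewrite [X in (_ + X)%E](_ : _ = 0%E) ?adde0//.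
apply/eqP; rewrite -measure_le0 -[leRHS](lebesgue_measure_set1 (1 : R)).
by apply: le_measure => //; rewrite inE//; exact: measurableI.
Qed.

Lemma Pr_preserving (f : Omega -> Omega) : measurable_fun setT f ->
  (forall x, Pr (f @^-1` cyl x) = Pr (cyl x)) ->
  forall A, measurable A -> Pr (f @^-1` A) = Pr A.
Proof.
move=> mf fcyl.
pose F : {mfun Omega >-> Omega} := HB.pack f (isMeasurableFun.Build _ _ _ _ f mf).
apply: (@Omega_measure_unique R (distribution Pr F) Pr) => //.
exact: le_lt_trans (probability_le1 _ measurableT) (ltry _).
Qed.

(* A measure-preserving map sending any given point to any other one. *)
Definition flip (c alpha : Omega) : Omega := fun n => alpha n (+) c n.

Lemma measurable_flip c : measurable_fun setT (flip c).
Proof.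
apply: measurable_to_Omega => n b.
rewrite (_ : mkset _ = [set a : Omega | a n = b (+) c n]); first exact: measurable_coord.
by apply/seteqP; split=> a; rewrite /flip /=;
  [move=> <-; rewrite addbK|move=> ->; rewrite addbK].
Qed.

Lemma Pr_flip c A : measurable A -> Pr (flip c @^-1` A) = Pr A.
Proof.
apply: Pr_preserving => [|x]; first exact: measurable_flip.
rewrite (_ : _ @^-1` _ = cyl (mkseq (fun i => nth false x i (+) c i) (size x))).
  by rewrite !Pr_cyl size_mkseq.
apply/seteqP; split=> a; rewrite /cyl /= !prefix_ofP size_mkseq => h i ix;
  have := h i ix; rewrite nth_mkseq// /flip; first by move=> <-; rewrite addbK.
by move=> ->; rewrite addbK.
Qed.

Lemma measurable_reindex f : measurable_fun setT (reindex f).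
Proof. by apply: measurable_to_Omega => n b; exact: measurable_coord. Qed.

Lemma Pr_reindex f A : injective f -> measurable A ->
  Pr (reindex f @^-1` A) = Pr A.
Proof.
move=> finj; apply: Pr_preserving; first exact: measurable_reindex.
move=> x; rewrite Pr_cyl; elim: x f finj => [|b x ih] f finj.
  by rewrite cyl_nil preimage_setT probability_setT.
set B := reindex (f \o S) @^-1` cyl x.
have mB : measurable B.
  by rewrite -[B]setTI; exact: measurable_reindex (measurable_cyl x).
have cB : Pr B = (2^-1 ^+ size x)%:E by apply: ih => i j /finj[].
pose H b := [set a : Omega | a (f 0%N) = b] `&` B.
have mH c : measurable (H c) by apply: measurableI => //; exact: measurable_coord.
have -> : reindex f @^-1` cyl (b :: x) = H b.
  by apply/seteqP; split=> a; rewrite /H /B /cyl /= prefix_of_cons.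
have HN : Pr (H (~~ b)) = Pr (H b).
  rewrite -[RHS](Pr_flip (fun n => n == f 0%N))//; congr (Pr _).
  have fB a : reindex (f \o S) (flip (fun n => n == f 0%N) a) = reindex (f \o S) a.
    apply/funext => i; rewrite /reindex /flip /= (_ : _ == _ = false) ?addbF//.
    by apply/eqP => /finj.
  apply/seteqP; split=> a; rewrite /H /B /= /flip fB eqxx addbT => -[h ?]; split=> //.
    by rewrite h negbK.
  by rewrite -h negbK.
have : Pr B = (Pr (H b) + Pr (H (~~ b)))%E.
  rewrite -measureU//.
    congr (Pr _); apply/seteqP; split=> a; last by case=> -[].
    move=> Ba; rewrite /H /=.
    by case: (a (f 0%N)); case: (b); [left|right|right|left].
  by apply/seteqP; split=> a //; rewrite /H => -[[/= ab _] [/= ab' _]]; move: ab'; rewrite ab; case: (b).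
rewrite HN cB => h.
have [p pE] : exists p, Pr (H b) = p%:E.
  by exists (fine (Pr (H b))); rewrite fineK//; exact: fin_num_measure.
move: h; rewrite pE -EFinD => -[h].
by congr (_%:E); rewrite exprS; lra.
Qed.

Record tossing := Tossing {
  toss :> Omega -> Omega ;
  measurable_toss : measurable_fun setT toss ;
  Pr_toss : forall A, measurable A -> Pr (toss @^-1` A) = Pr A }.

Lemma measurable_reindex_toss f (T : tossing) :
  measurable_fun setT (reindex f \o T).
Proof. exact: measurableT_comp (measurable_reindex f) (measurable_toss T). Qed.

Lemma Pr_reindex_toss f (T : tossing) : injective f -> forall A, measurable A ->
  Pr ((reindex f \o T) @^-1` A) = Pr A.
Proof.
move=> finj A mA; rewrite comp_preimage Pr_toss ?Pr_reindex//.
by rewrite -[_ @^-1` _]setTI; exact: measurable_reindex.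
Qed.

Lemma third_inj i : injective (fun n => i + 3 * n)%N.
Proof. by move=> m n /addnI /eqP; rewrite eqn_pmul2l// => /eqP. Qed.

Definition tl_toss (T : tossing) : tossing :=
  Tossing (measurable_reindex_toss S T) (Pr_reindex_toss T succn_inj).

Definition third_toss (i : nat) (T : tossing) : tossing :=
  Tossing (measurable_reindex_toss (fun n => i + 3 * n)%N T)
          (Pr_reindex_toss T (@third_inj i)).

End Pr.

(* Triples over nat are coded injectively by positive numbers and the empty
   element of Q_0 by 0, so that every Q_n is a set of numbers, and the union
   defining Q_(n+1) from Q_n identifies a triple of Q_n with the same triple
   formed at stage n + 1. [atom_neq_triple], [triple_inj] and [Q_ind] say that
   Q is the least solution of Q = {atom} + 2^* x P_fin(Q) x Q. *)
Definition code (x : seq bool) (c : {fset nat}) (q : nat) : nat :=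
  (choice.pickle (x, c, q)).+1.

Fixpoint Qstage (n : nat) : set nat :=
  if n is m.+1 then
    Qstage m `|`
    [set k | exists x c q, [/\ [set` c] `<=` Qstage m, Qstage m q & k = code x c q]]
  else [set 0%N].

Record Q := MkQ { Qval : nat; QvalP : Qval \in \bigcup_n Qstage n }.
HB.instance Definition _ := [isSub for Qval].
HB.instance Definition _ := [Countable of Q by <:].

Definition atom : Q := @MkQ 0%N (mem_set (ex_intro2 _ _ 0%N I erefl)).

Lemma Qstage_le m n : (m <= n)%N -> Qstage m `<=` Qstage n.
Proof.
move=> /subnK <-; elim: (n - m)%N => [|d ih] //.
by apply: subset_trans ih _ => k; left.
Qed.

Lemma triple_subproof (x : seq bool) (c : {fset Q}) (q : Q) :
  code x [fset val p | p in c]%fset (val q) \in \bigcup_n Qstage n.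
Proof.
have /boolp.choice[s sP] (p : Q) : exists n, Qstage n (val p).
  by have /set_mem[n _ ?] := QvalP p; exists n.
pose n := (s q + \sum_(p <- c) s p)%N.
apply/mem_set; exists n.+1 => //; right.
exists x, [fset val p | p in c]%fset, (val q); split=> //; last first.
  by apply: Qstage_le (sP q); rewrite leq_addr.
move=> _ /imfsetP[p /= pc ->]; apply: Qstage_le (sP p).
by rewrite /n (big_fsetD1 p)//= addnCA leq_addr.
Qed.

Definition triple (x : seq bool) (c : {fset Q}) (q : Q) : Q :=
  MkQ (triple_subproof x c q).

Lemma atom_neq_triple x c q : atom <> triple x c q.
Proof. by move=> /(congr1 val). Qed.

Lemma triple_inj x c q x' c' q' :
  triple x c q = triple x' c' q' -> [/\ x = x', c = c' & q = q'].
Proof.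
move=> /(congr1 val)[] /(pcan_inj choice.pickleK)[-> cc /val_inj->].
have sub (d d' : {fset Q}) : [fset Qval p | p in d]%fset = [fset Qval p | p in d']%fset ->
    {subset d <= d'}.
  move=> dd p pd; have : Qval p \in [fset Qval p | p in d]%fset by exact: in_imfset.
  by rewrite dd => /imfsetP[p' /= + /val_inj ->].
by split=> //; apply/fsetP => p; apply/idP/idP; exact: sub.
Qed.

Lemma Q_ind (P : Q -> Prop) : P atom ->
  (forall x (c : {fset Q}) q, (forall p, p \in c -> P p) -> P q -> P (triple x c q)) ->
  forall q, P q.
Proof.
move=> P0 PS.
suff h n k (kn : Qstage n k) : exists2 q : Q, val q = k & P q.
  by move=> q; have /set_mem[n _ /h[p /val_inj <-]] := QvalP q.
elim: n k kn => [|n ih] k; first by move=> ->; exists atom.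
case=> [/ih//|[x [c [q [cn /ih[q' <- Pq'] ->]]]]].
pose c' : {fset Q} := [fset p in pmap insub (enum_fset c)]%fset.
have mc' p : (p \in c') = (val p \in c).
  by rewrite !inE /= mem_pmap_sub.
exists (triple x c' q'); last first.
  apply: PS => // p; rewrite mc' => /cn/ih[p' /val_inj <-] //.
rewrite /=; congr code; apply/fsetP => j.
apply/imfsetP/idP => /= [[p + ->]|jc]; first by rewrite mc'.
by have [p pj _] := ih _ (cn _ jc); exists p; rewrite ?mc' pj.
Qed.

Definition Val := set Q.

Definition funV (a : Val) (beta : Omega) (v : Val) : Val :=
  [set q | exists x c, [/\ prefix_of x beta, [set` c] `<=` v & a (triple x c q)]].

Definition lamV (f : Omega -> Val -> Val) : Val :=
  [set p | exists x c q, p = triple x c q /\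
                         forall beta, cyl x beta -> f beta [set` c] q]
  `|` [set atom].

Definition strict (g : Val -> Val) (v : Val) : Val :=
  if `[< v = set0 >] then set0 else g v.

Section semantics.
Variable Var : countType.

Inductive term : Type :=
| tvar of Var
| tabs of Var & term
| tapp of term & term
| tchoice of term & term.

Fixpoint FV (M : term) : set Var :=
  match M with
  | tvar x => [set x]
  | tabs x M => FV M `\ x
  | tapp M N | tchoice M N => FV M `|` FV N
  end.

Definition update (A : Type) (e : Var -> A) (x : Var) (v : A) : Var -> A :=
  fun y => if y == x then v else e y.

Fixpoint sem (M : term) (e : Var -> Val) (alpha : Omega) : Val :=
  match M with
  | tvar x => e x
  | tabs x M => lamV (fun beta => strict (fun v => sem M (update e x v) beta))
  | tapp M N => funV (sem M e (third 0 alpha)) (third 1 alpha)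
                     (sem N e (third 2 alpha))
  | tchoice M N => if hd alpha then sem M e (tl alpha) else sem N e (tl alpha)
  end.

Definition RV := Omega -> Val.

Variable R : realType.

Definition represents (f : Omega -> Omega -> Val -> Val)
    (Phi : tossing R -> RV -> option RV) : Prop :=
  (forall omega beta, f omega beta set0 = set0) /\
  forall (T : tossing R) (X : RV), exists2 Y, Phi T X = Some Y &
    forall omega, X omega <> set0 -> Y omega = f omega (T omega) (X omega).

(* Such an f is unique, since a tossing process can take any value at a given
   omega; hence the choice made by [cid] is immaterial. *)
Definition lamRV (Phi : tossing R -> RV -> option RV) : option RV :=
  match pselect (exists f, represents f Phi) with
  | left h => Some (fun omega => lamV (projT1 (cid h) omega))
  | right _ => None
  end.

(* [None] stands for undefined. *)
Fixpoint psi (M : term) (E : Var -> RV) (T : tossing R) : option RV :=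
  match M with
  | tvar x => Some (E x)
  | tabs x M => lamRV (fun T' X => psi M (update E x X) T')
  | tapp M N =>
      match psi M E (third_toss 0 T), psi N E (third_toss 2 T) with
      | Some F, Some G =>
          Some (fun omega => funV (F omega) (third 1 (T omega)) (G omega))
      | _, _ => None
      end
  | tchoice M N =>
      match psi M E (tl_toss T), psi N E (tl_toss T) with
      | Some F, Some G =>
          Some (fun omega => if hd (T omega) then F omega else G omega)
      | _, _ => None
      end
  end.

End semantics.

(* Main.v *)
(** The equation holds for every stochastic environment [E], with the
    environment [E _ omega] on the left: the value of [psi M E T] at [omega]
    depends only on [T omega] and on the values of [E] at [omega]. For an
    abstraction, this pointwise form exhibits a representing function, and a
    representing function is unique because flipping coins gives a tossing
    process through any prescribed pair of points. *)
Require Import Defs.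
From mathcomp Require Import all_boot all_classical all_reals.

Set Implicit Arguments.
Unset Strict Implicit.
Unset Printing Implicit Defensive.

Local Open Scope classical_set_scope.

Definition flip_toss (R : realType) (c : Omega) : tossing R :=
  Tossing (measurable_flip c) (Pr_flip R c).

Lemma tossing_through (R : realType) (omega beta : Omega) :
  exists T : tossing R, T omega = beta.
Proof.
(* The mask is the bitwise difference of the two points, so flipping [omega] by it gives [beta]. *)
exists (flip_toss R (flip omega beta)); apply/funext => n /=.
by rewrite /flip addbC addbK.
Qed.

Lemma represents_unique (R : realType) (Phi : tossing R -> RV -> option RV)
    (f g : Omega -> Omega -> Val -> Val) :
  represents f Phi -> represents g Phi -> f = g.
Proof.
move=> [f0 fPhi] [g0 gPhi]; apply/funext => omega; apply/funext => beta.
apply/funext => v.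
have [->|v0] := pselect (v = set0); first by rewrite f0 g0.
have [T <-] := tossing_through R omega beta.
(* A constant random variable probes both functions at the given [v]. *)
have [Y PhiY Yf] := fPhi T (fun=> v).
have [Z] := gPhi T (fun=> v); rewrite PhiY => -[<-] Yg.
by rewrite -(Yf omega v0) -(Yg omega v0).
Qed.

Lemma lamRV_represents (R : realType) (Phi : tossing R -> RV -> option RV)
    (f : Omega -> Omega -> Val -> Val) :
  represents f Phi -> lamRV Phi = Some (fun omega => lamV (f omega)).
Proof.
move=> fPhi; rewrite /lamRV; case: pselect => [h|[]]; last by exists f.
by case: cid => g /= gPhi; rewrite (represents_unique gPhi fPhi).
Qed.

Lemma strict_set0 (g : Val -> Val) : strict g set0 = set0.
Proof. by rewrite /strict asboolT. Qed.

Lemma strict_neq0 (g : Val -> Val) (v : Val) : v <> set0 -> strict g v = g v.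
Proof. by move=> v0; rewrite /strict asboolF. Qed.

Lemma psi_sem (R : realType) (Var : countType) (M : term Var)
    (E : Var -> RV) (T : tossing R) :
  psi M E T = Some (fun omega => sem M (E^~ omega) (T omega)).
Proof.
elim: M E T => [x|x M IHM|M IHM N IHN|M IHM N IHN] E T //=;
  (* In application and choice, [third_toss] and [tl_toss] at [omega] convert to the coins that
     [sem] reads from [T omega]. *)
  [|by rewrite IHM IHN..].
pose f omega beta := strict (fun v => sem M (update (E^~ omega) x v) beta).
rewrite (@lamRV_represents _ _ f) //; split=> [omega beta|T' X].
  exact: strict_set0.
(* Definedness is the induction hypothesis at [update E x X] and [T']. *)
exists (fun omega => sem M ((update E x X)^~ omega) (T' omega)) => // omega X0.
rewrite /f strict_neq0//; congr sem; apply/funext => y.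
by rewrite /update; case: ifP.
Qed.

Theorem mainTheorem2 (R : realType) (Var : countType) (M : term Var)
    (e : Var -> Val) (T : tossing R)
    (He : FV M `<=` [set x | e x <> set0]) :
  Some (fun omega => sem M e (T omega)) = psi M (fun x omega => e x) T.
Proof. by rewrite psi_sem. Qed.
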